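(* Let $H$ be a Hopf algebra with invertible antipode over a field $k$ of characteristic $0$. For right $H$-comodules $T, W, V$ there are isomorphisms, natural in $T$, $W$ and $V$, $$\mathrm{Hom}(T\otimes W,V)^H\simeq \mathrm{Hom}(T,\mathrm{Hom}^l(W,V))^H,$$ i.e., $\mathrm{Hom}^l(-,-)$ is the left internal Hom in the monoidal category $\mathcal{M}^H$ of right $H$-comodules.
   Context: Sweedler notation: $\Delta(h)=h^1\otimes h^2$; a right coaction is written $v\mapsto v_0\otimes v_1$. $S$ is the antipode. $\mathcal{M}^H$ is monoidal with coaction $m\otimes n\mapsto m_0\otimes n_0\otimes m_1n_1$ on $M\otimes N$. $\mathrm{Hom}(-,-)$ denotes $k$-linear maps and $\mathrm{Hom}(-,-)^H$ denotes $H$-comodule maps. For $W,V\in\mathcal{M}^H$ define $\rho:\mathrm{Hom}(W,V)\to\mathrm{Hom}(W,V\otimes H)$ by $(\rho f)(w)=f(w_0)_0\otimes f(w_0)_1S(w_1)$. Then $\mathrm{Hom}^l(W,V)$ is the subspace of those $f\in \mathrm{Hom}(W,V)$ such that $\rho f\in \mathrm{Hom}(W,V)\otimes H\subset \mathrm{Hom}(W,V\otimes H)$. It is a right $H$-comodule with coaction $\rho$ (in particular $\rho$ maps $\mathrm{Hom}^l(W,V)$ to $\mathrm{Hom}^l(W,V)\otimes H$), contravariantly functorial in $W$ and covariantly functorial in $V$ by composition with comodule maps. *)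

(* Defs.v *)
From HB Require Import structures.
From mathcomp Require Import all_boot all_algebra generic_quotient.
From mathcomp Require Import boolp classical_sets functions.

Set Implicit Arguments.
Unset Strict Implicit.
Unset Printing Implicit Defensive.

Import GRing.Theory.
Local Open Scope ring_scope.
Local Open Scope quotient_scope.

Section LinearMaps.
Variables (k : fieldType) (U V : lmodType k).

Definition linear_pred : {pred U -> V} := [pred f : U -> V | `[< linear f >]].

Record linhom := LinHom { hom_fun :> U -> V; _ : hom_fun \in linear_pred }.

HB.instance Definition _ := [isSub for hom_fun].
HB.instance Definition _ := [Choice of linhom by <:].

Lemma linear_pred_closed : subsemimod_closed linear_pred.
Proof.
split.
  split; first by apply/asboolP => a x y;
    rewrite -[RHS]/(a *: 0 + 0) scaler0 addr0.
  move=> f g /asboolP fl /asboolP gl; apply/asboolP => a x y.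
  by rewrite -[RHS]/(a *: (f x + g x) + (f y + g y))
    -[LHS]/(f _ + g _) fl gl scalerDr addrACA.
move=> c f /asboolP fl; apply/asboolP => a x y.
by rewrite -[RHS]/(a *: (c *: f x) + c *: f y)
  -[LHS]/(c *: f _) fl scalerDr !scalerA mulrC.
Qed.

HB.instance Definition _ :=
  GRing.SubChoice_isSubLmodule.Build k (U -> V) linear_pred linhom
    linear_pred_closed.

Lemma hom_linear (f : linhom) : linear f.
Proof. by case: f => f /= /asboolP. Qed.

HB.instance Definition _ (f : linhom) :=
  GRing.isLinear.Build k U V *:%R (hom_fun f) (hom_linear f).

Definition mkhom (f : U -> V) (fl : linear f) : linhom := LinHom (asboolT fl).

Lemma homP (f g : linhom) : f =1 g -> f = g.
Proof. by move=> fg; apply/val_inj/funext. Qed.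

Lemma homDE (f g : linhom) x : (f + g) x = f x + g x.
Proof. by []. Qed.

Lemma homZE a (f : linhom) x : (a *: f) x = a *: f x.
Proof. by []. Qed.
End LinearMaps.

Section Tensor.
Variables (k : fieldType) (U V : lmodType k).

(* U ⊗ V is the quotient of formal sums of pure tensors, i.e. of sequences of
   pairs, by the congruence generated by the bilinearity relations.  The scalar
   of a summand is absorbed in its first component. *)
Inductive tensor_eq : seq (U * V) -> seq (U * V) -> Prop :=
| teq_refl s : tensor_eq s s
| teq_sym s t : tensor_eq s t -> tensor_eq t s
| teq_trans s t r : tensor_eq s t -> tensor_eq t r -> tensor_eq s r
| teq_cat s s' t t' :
    tensor_eq s s' -> tensor_eq t t' -> tensor_eq (s ++ t) (s' ++ t')
| teq_catC s t : tensor_eq (s ++ t) (t ++ s)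
| teq_0 v : tensor_eq [:: (0, v)] [::]
| teq_Dl u u' v : tensor_eq [:: (u + u', v)] [:: (u, v); (u', v)]
| teq_Dr u v v' : tensor_eq [:: (u, v + v')] [:: (u, v); (u, v')]
| teq_Z a u v : tensor_eq [:: (a *: u, v)] [:: (u, a *: v)].

Definition tensor_eqb : rel (seq (U * V)) := fun s t => `[< tensor_eq s t >].

Lemma tensor_eqb_equiv : equiv_class_of tensor_eqb.
Proof.
split=> [s|s t|t s r].
- exact/asboolP/teq_refl.
- by apply/asboolP/asboolP; apply: teq_sym.
- by move=> /asboolP st /asboolP tr; apply/asboolP/(teq_trans st tr).
Qed.

Canonical tensor_equiv := EquivRelPack tensor_eqb_equiv.

Definition tensor := {eq_quot tensor_equiv}.
HB.instance Definition _ := Choice.on tensor.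

Definition tpi (s : seq (U * V)) : tensor := \pi_{eq_quot tensor_equiv} s.
Definition trepr (x : tensor) : seq (U * V) := repr x.

Lemma treprK x : tpi (trepr x) = x.
Proof. exact: reprK. Qed.

Lemma tpiP s t : tpi s = tpi t <-> tensor_eq s t.
Proof.
split=> [|st]; first by move=> /eqmodP/asboolP.
exact/eqmodP/asboolP.
Qed.

Lemma trepr_pi s : tensor_eq (trepr (tpi s)) s.
Proof. by apply/tpiP; rewrite treprK. Qed.

Definition tadd x y := tpi (trepr x ++ trepr y).
Definition tscale a x := tpi [seq (a *: p.1, p.2) | p <- trepr x].

Lemma tadd_pi s t : tadd (tpi s) (tpi t) = tpi (s ++ t).
Proof. by apply/tpiP/teq_cat; apply: trepr_pi. Qed.

Lemma teq_scale a s t : tensor_eq s t ->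
  tensor_eq [seq (a *: p.1, p.2) | p <- s] [seq (a *: p.1, p.2) | p <- t].
Proof.
elim=> {s t} [s|s t _|s t r _ ih _|s s' t t' _ ihs _ iht|s t|v|u u' v|u v v'
  |b u v] /=.
- exact: teq_refl.
- exact: teq_sym.
- exact: teq_trans.
- by rewrite !map_cat; apply: teq_cat.
- by rewrite !map_cat; apply: teq_catC.
- by rewrite scaler0; apply: teq_0.
- by rewrite scalerDr; apply: teq_Dl.
- exact: teq_Dr.
- by rewrite scalerA mulrC -scalerA; apply: teq_Z.
Qed.

Lemma tscale_pi a s : tscale a (tpi s) = tpi [seq (a *: p.1, p.2) | p <- s].
Proof. by apply/tpiP/teq_scale/trepr_pi. Qed.

Lemma taddA : associative tadd.
Proof.
move=> x y z; rewrite -[x]treprK -[y]treprK -[z]treprK.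
by rewrite !tadd_pi catA.
Qed.

Lemma taddC : commutative tadd.
Proof. by move=> x y; apply/tpiP/teq_catC. Qed.

Lemma tadd0 : left_id (tpi [::]) tadd.
Proof. by move=> x; rewrite -[x]treprK tadd_pi. Qed.

Lemma taddN : left_inverse (tpi [::]) (tscale (-1)) tadd.
Proof.
move=> x; rewrite -[x]treprK tscale_pi tadd_pi.
elim: (trepr x) => [//|[u v] s ih].
apply: etrans ih; apply/tpiP => /=; set s' := map _ s.
rewrite scaleN1r.
apply: (@teq_trans _ ([:: (- u, v); (u, v)] ++ (s' ++ s))).
  apply: (@teq_cat [:: (- u, v)] [:: (- u, v)]); first exact: teq_refl.
  rewrite -[(u, v) :: s]cat1s -[X in tensor_eq _ X]cat1s !catA.
  by apply: teq_cat; [apply: teq_catC|apply: teq_refl].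
apply: (@teq_cat _ [::]); last exact: teq_refl.
apply: teq_trans (teq_sym (teq_Dl _ _ _)) _.
by rewrite addNr; apply: teq_0.
Qed.

HB.instance Definition _ :=
  GRing.isZmodule.Build tensor taddA taddC tadd0 taddN.

Lemma tpi_cat s t : tpi (s ++ t) = tpi s + tpi t.
Proof. by rewrite -tadd_pi. Qed.

Definition tens (u : U) (v : V) : tensor := tpi [:: (u, v)].

Lemma tpi_cons p s : tpi (p :: s) = tens p.1 p.2 + tpi s.
Proof. by rewrite /tens -tpi_cat; case: p. Qed.

Lemma tscaleA a b x : tscale a (tscale b x) = tscale (a * b) x.
Proof.
rewrite -[x]treprK !tscale_pi -map_comp; congr tpi.
by apply: eq_map => p /=; rewrite scalerA.
Qed.

Lemma tscale1 : left_id 1 tscale.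
Proof.
move=> x; rewrite -[x]treprK tscale_pi; congr tpi.
by rewrite -[RHS]map_id; apply: eq_map => -[u v] /=; rewrite scale1r.
Qed.

Lemma tscaleDr : right_distributive tscale +%R.
Proof.
by move=> a x y; rewrite -[x]treprK -[y]treprK -tpi_cat
  !tscale_pi -tpi_cat map_cat.
Qed.

Lemma tscaleDl x : {morph tscale^~ x : a b / a + b}.
Proof.
move=> a b; rewrite -[x]treprK !tscale_pi.
elim: (trepr x) => [|[u v] s ih]; first by rewrite /= addr0.
rewrite /= !tpi_cons ih /= addrACA; congr (_ + _).
by rewrite /tens -tpi_cat scalerDl; apply/tpiP/teq_Dl.
Qed.

HB.instance Definition _ := GRing.Zmodule_isLmodule.Build k tensor
  tscaleA tscale1 tscaleDr tscaleDl.

Lemma scale_tpi a s : a *: tpi s = tpi [seq (a *: p.1, p.2) | p <- s].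
Proof. exact: tscale_pi. Qed.

Lemma tens_linearl v : linear (tens^~ v).
Proof.
move=> a u u'; rewrite /tens scale_tpi /= -tpi_cat; exact/tpiP/teq_Dl.
Qed.

Lemma tens_linearr u : linear (tens u).
Proof.
move=> a v v'; rewrite /tens scale_tpi /= -tpi_cat; apply/tpiP.
apply: (teq_trans (teq_Dr _ _ _)).
apply: (@teq_cat [:: (_, _)] [:: (_, _)] [:: (_, _)]); last exact: teq_refl.
exact/teq_sym/teq_Z.
Qed.

Lemma tpi_sum s : tpi s = \sum_(p <- s) tens p.1 p.2.
Proof.
elim: s => [|[u v] s ih]; first by rewrite big_nil.
by rewrite big_cons tpi_cons ih.
Qed.

Lemma tensor_sum x : x = \sum_(p <- trepr x) tens p.1 p.2.
Proof. by rewrite -tpi_sum treprK. Qed.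

End Tensor.

Notation "U ⊗ V" := (tensor U V) (at level 40, left associativity) : type_scope.
Notation "u ⊗t v" := (tens u v) (at level 40, left associativity) : ring_scope.

Section Lift.
Variables (k : fieldType) (U V W : lmodType k).

Definition bilin (b : U -> V -> W) :=
  (forall v, linear (b^~ v)) /\ (forall u, linear (b u)).

(* tlift b is the linear map induced by b when b is bilinear (tliftE and
   tlift_linear; tensor_ext gives uniqueness); it is junk for other b.  With
   comul or a coaction as argument it renders Sweedler sums:
   tlift (fun v0 v1 => E) (coact V v) is E summed over v_0 ⊗ v_1. *)
Definition tlift (b : U -> V -> W) (x : U ⊗ V) : W :=
  \sum_(p <- trepr x) b p.1 p.2.

Lemma tlift_pi b s : bilin b -> tlift b (tpi s) = \sum_(p <- s) b p.1 p.2.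
Proof.
move=> [bl br]; rewrite /tlift; move: (trepr_pi s).
have b0 v : b 0 v = 0.
  by have := bl v (-1) 0 0; rewrite scaler0 addr0 scaleN1r addNr.
have bD v : {morph b^~ v : x y / x + y}.
  by move=> x y /=; have := bl v 1 x y; rewrite !scale1r.
have b0r u : b u 0 = 0.
  by have := br u (-1) 0 0; rewrite scaler0 addr0 scaleN1r addNr.
have bDr u : {morph b u : x y / x + y}.
  by move=> x y /=; have := br u 1 x y; rewrite !scale1r.
move: (trepr _) => r.
elim=> {s r} [s|s t _|s t r _ -> _|s s' t t' _ ihs _ iht|s t|v|u u' v|u v v'
  |a u v] //=.
- by rewrite !big_cat /= ihs iht.
- by rewrite !big_cat /= addrC.
- by rewrite big_seq1 big_nil b0.
- by rewrite big_seq1 2!big_cons big_nil addr0 bD.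
- by rewrite big_seq1 2!big_cons big_nil addr0 bDr.
- rewrite !big_seq1 /=.
  have := bl v a u 0; have := br u a v 0; rewrite !addr0 b0 b0r !addr0.
  by move=> -> ->.
Qed.

Lemma tliftE b u v : bilin b -> tlift b (u ⊗t v) = b u v.
Proof. by move=> bb; rewrite tlift_pi // big_seq1. Qed.

Lemma tlift_linear b : bilin b -> linear (tlift b).
Proof.
move=> bb a x y; rewrite -[x]treprK -[y]treprK scale_tpi -tpi_cat.
rewrite !tlift_pi // big_cat /= big_map scaler_sumr; congr (_ + _).
apply: eq_bigr => p _ /=.
have b0 v : b 0 v = 0.
  by have := bb.1 v (-1) 0 0; rewrite scaler0 addr0 scaleN1r addNr.
by have := bb.1 p.2 a p.1 0; rewrite b0 !addr0.
Qed.

Lemma tensor_ext (f g : U ⊗ V -> W) : linear f -> linear g ->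
  (forall u v, f (u ⊗t v) = g (u ⊗t v)) -> f =1 g.
Proof.
move=> fl gl fg x; pose f' := mkhom fl; pose g' := mkhom gl.
rewrite -[f x]/(f' x) -[g x]/(g' x) [x]tensor_sum !linear_sum.
by apply: eq_bigr => p _; apply: fg.
Qed.

End Lift.

Section LinearLemmas.
Variables (k : fieldType).
Implicit Types U V W X : lmodType k.

Lemma lin_id U : linear (fun x : U => x).
Proof. by []. Qed.

Lemma linZ U V (f : U -> V) a x : linear f -> f (a *: x) = a *: f x.
Proof. by move=> fl; rewrite -[f]/(hom_fun (mkhom fl)) linearZ. Qed.

Lemma lin_hom X U V (f : linhom U V) (g : X -> U) :
  linear g -> linear (fun x => f (g x)).
Proof. by move=> gl a x y; rewrite gl linearP. Qed.

Lemma lin_tensl X U V (g : X -> U) (v : V) :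
  linear g -> linear (fun x => g x ⊗t v).
Proof. by move=> gl a x y; rewrite gl tens_linearl. Qed.

Lemma lin_tensr X U V (u : U) (g : X -> V) :
  linear g -> linear (fun x => u ⊗t g x).
Proof. by move=> gl a x y; rewrite gl tens_linearr. Qed.

Lemma lin_tlift X U V W (b : U -> V -> W) (g : X -> U ⊗ V) :
  bilin b -> linear g -> linear (fun x => tlift b (g x)).
Proof. by move=> bb gl a x y; rewrite gl tlift_linear. Qed.

Lemma lin_tlift_par X U V W (b : X -> U -> V -> W) (t : U ⊗ V) :
  (forall u v, linear (fun x => b x u v)) -> linear (fun x => tlift (b x) t).
Proof.
move=> bl a x y; rewrite /tlift scaler_sumr -big_split /=.
by apply: eq_bigr => p _; apply: bl.
Qed.

Lemma lin_mull X (A : algType k) (g : X -> A) (b : A) :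
  linear g -> linear (fun x => g x * b).
Proof. by move=> gl a x y; rewrite gl mulrDl scalerAl. Qed.

Lemma lin_mulr X (A : algType k) (b : A) (g : X -> A) :
  linear g -> linear (fun x => b * g x).
Proof. by move=> gl a x y; rewrite gl mulrDr scalerAr. Qed.

Lemma lin_scalel X U (g : X -> k^o) (u : U) :
  linear g -> linear (fun x => g x *: u).
Proof. by move=> gl a x y; rewrite gl scalerDl scalerA. Qed.

Lemma lin_scaler X U (c : k) (g : X -> U) :
  linear g -> linear (fun x => c *: g x).
Proof. by move=> gl a x y; rewrite gl scalerDr !scalerA mulrC. Qed.

Lemma lin_app X U V (g : X -> linhom U V) (u : U) :
  linear g -> linear (fun x => g x u).
Proof. by move=> gl a x y; rewrite gl. Qed.

End LinearLemmas.

(* [lin] proves linearity and bilinearity of Sweedler-style expressions. *)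
Ltac lin_ext := fail.
Ltac lin_step :=
  match goal with
  | |- bilin _ => split=> ? /=
  | |- forall _, _ => intro
  | |- GRing.linear_for _ (fun x => x) => apply: lin_id
  | |- GRing.linear_for _ (tens _) => apply: tens_linearr
  | |- GRing.linear_for _ (tlift _) => apply: tlift_linear
  | |- GRing.linear_for _ (hom_fun _) => apply: hom_linear
  | |- GRing.linear_for _ (fun x => hom_fun ?f (@?g x)) =>
      apply: (@lin_hom _ _ _ _ f g)
  | |- GRing.linear_for _ (fun x => hom_fun (@?g x) ?u) =>
      apply: (@lin_app _ _ _ _ g u)
  | |- GRing.linear_for _ (fun x => tens (@?g x) ?v) =>
      apply: (@lin_tensl _ _ _ _ g v)
  | |- GRing.linear_for _ (fun x => tens ?v (@?g x)) =>
      apply: (@lin_tensr _ _ _ _ v g)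
  | |- GRing.linear_for _ (fun x => tlift ?b (@?g x)) =>
      apply: (@lin_tlift _ _ _ _ _ b g)
  | |- GRing.linear_for _ (fun x => tlift (@?b x) ?t) =>
      apply: (@lin_tlift_par _ _ _ _ _ b t) => /=
  | |- GRing.linear_for _ (fun x => @?g x * ?b) =>
      apply: (@lin_mull _ _ _ g b)
  | |- GRing.linear_for _ (fun x => ?b * @?g x) =>
      apply: (@lin_mulr _ _ _ b g)
  | |- GRing.linear_for _ (fun x => @?g x *: ?b) =>
      apply: lin_scalel
  | |- GRing.linear_for _ (fun x => ?b *: @?g x) =>
      apply: lin_scaler
  | |- _ => lin_ext
  end.
Ltac lin := solve [repeat lin_step].

Section LiftLemmas.
Variables (k : fieldType).
Implicit Types U V W X : lmodType k.

Lemma eq_tlift U V W (b b' : U -> V -> W) x :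
  (forall u v, b u v = b' u v) -> tlift b x = tlift b' x.
Proof. by move=> bb'; apply: eq_bigr => p _. Qed.

Lemma tlift_push U V W X (f : W -> X) (b : U -> V -> W) x :
  linear f -> f (tlift b x) = tlift (fun u v => f (b u v)) x.
Proof.
by move=> fl; rewrite -[f]/(hom_fun (mkhom fl)) /tlift linear_sum.
Qed.

Lemma tlift_exchange U V U' V' W (F : U -> V -> U' -> V' -> W) x y :
  tlift (fun u v => tlift (F u v) y) x =
  tlift (fun u' v' => tlift (fun u v => F u v u' v') x) y.
Proof. by rewrite /tlift exchange_big. Qed.

Lemma tlift_tens U V (x : U ⊗ V) : tlift (@tens _ U V) x = x.
Proof. by rewrite /tlift -tensor_sum. Qed.

Definition tmap U V U' V' (f : U -> U') (g : V -> V') : U ⊗ V -> U' ⊗ V' :=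
  tlift (fun u v => f u ⊗t g v).

Definition tassoc U V W : (U ⊗ V) ⊗ W -> U ⊗ (V ⊗ W) :=
  tlift (fun x w => tlift (fun u v => u ⊗t (v ⊗t w)) x).

Definition tmul (A B : algType k) (x y : A ⊗ B) : A ⊗ B :=
  tlift (fun a b => tlift (fun a' b' => (a * a') ⊗t (b * b')) y) x.

Lemma tmulE (A B : algType k) (a a' : A) (b b' : B) :
  tmul (a ⊗t b) (a' ⊗t b') = (a * a') ⊗t (b * b').
Proof. by rewrite /tmul !tliftE //; lin. Qed.

Lemma tmul_linearl (A B : algType k) (y : A ⊗ B) : linear (fun x => tmul x y).
Proof. rewrite /tmul; lin. Qed.

Lemma tmul_linearr (A B : algType k) (x : A ⊗ B) : linear (tmul x).
Proof. rewrite /tmul; lin. Qed.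

Lemma lin_tmull X (A B : algType k) (g : X -> A ⊗ B) y :
  linear g -> linear (fun x => tmul (g x) y).
Proof. by move=> gl a x x'; rewrite gl tmul_linearl. Qed.

Lemma lin_tmulr X (A B : algType k) (g : X -> A ⊗ B) y :
  linear g -> linear (fun x => tmul y (g x)).
Proof. by move=> gl a x x'; rewrite gl tmul_linearr. Qed.

Lemma tmulA (A B : algType k) : associative (@tmul A B).
Proof.
move=> x y z.
move: x; apply: tensor_ext => [||a b]; try by rewrite /tmul; lin.
move: y; apply: tensor_ext => [||a' b']; try by rewrite /tmul; lin.
move: z; apply: tensor_ext => [||a'' b'']; try by rewrite /tmul; lin.
by rewrite !tmulE !mulrA.
Qed.

Lemma tmul1x (A B : algType k) (x : A ⊗ B) : tmul (1 ⊗t 1) x = x.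
Proof.
by move: x; apply: tensor_ext => [||a b];
  [rewrite /tmul; lin|lin|rewrite tmulE !mul1r].
Qed.

Lemma tmulx1 (A B : algType k) (x : A ⊗ B) : tmul x (1 ⊗t 1) = x.
Proof.
by move: x; apply: tensor_ext => [||a b];
  [rewrite /tmul; lin|lin|rewrite tmulE !mulr1].
Qed.

Lemma tlift_tmap U V U' V' W (b : U' -> V' -> W) (f : linhom U U') (g : linhom V V')
    x : bilin b -> tlift b (tmap f g x) = tlift (fun u v => b (f u) (g v)) x.
Proof.
move=> bb; rewrite /tmap tlift_push; last exact: tlift_linear.
by apply: eq_tlift => u v; rewrite tliftE.
Qed.

Lemma tmapE U V U' V' (f : linhom U U') (g : linhom V V') u v :
  tmap f g (u ⊗t v) = f u ⊗t g v.
Proof. by rewrite /tmap tliftE //; lin. Qed.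

Lemma tmap_linear U V U' V' (f : linhom U U') (g : linhom V V') :
  linear (tmap f g).
Proof. rewrite /tmap; lin. Qed.

End LiftLemmas.

Ltac lin_ext ::=
  match goal with
  | |- GRing.linear_for _ (tmul _) => apply: tmul_linearr
  | |- GRing.linear_for _ (fun x => tmul (@?g x) ?v) =>
      apply: (@lin_tmull _ _ _ _ g v)
  | |- GRing.linear_for _ (fun x => tmul ?v (@?g x)) =>
      apply: (@lin_tmulr _ _ _ _ g v)
  | |- GRing.linear_for _ (tmap _ _) => rewrite /tmap
  | |- GRing.linear_for _ (fun _ => tmap _ _ _) => rewrite /tmap
  end.

Section Homs.
Variables (k : fieldType).
Implicit Types U V W X : lmodType k.

Definition idhom U : linhom U U := mkhom (@lin_id k U).

Lemma comp_hom_linear U V W (g : linhom V W) (f : linhom U V) : linear (g \o f).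
Proof. rewrite /comp; lin. Qed.

Definition comp_hom U V W (g : linhom V W) (f : linhom U V) : linhom U W :=
  mkhom (comp_hom_linear g f).
End Homs.

Arguments idhom {k} U.

Record hopfAlgebra (k : fieldType) := HopfAlgebra {
  hopf_alg :> algType k;
  comul : linhom hopf_alg (hopf_alg ⊗ hopf_alg);
  counit : linhom hopf_alg k^o;
  antipode : linhom hopf_alg hopf_alg;
  comulA : forall h,
    tassoc (tmap comul (idhom hopf_alg) (comul h)) =
    tmap (idhom hopf_alg) comul (comul h);
  counitl : forall h, tlift (fun a b => (counit a : k) *: b) (comul h) = h;
  counitr : forall h, tlift (fun a b => (counit b : k) *: a) (comul h) = h;
  comulM : forall g h, comul (g * h) = tmul (comul g) (comul h);
  comul1 : comul 1 = 1 ⊗t 1;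
  counitM : forall g h, (counit (g * h) : k) = (counit g : k) * (counit h : k);
  counit1 : (counit 1 : k) = 1;
  antipodel : forall h,
    tlift (fun a b => antipode a * b) (comul h) = (counit h : k)%:A;
  antipoder : forall h,
    tlift (fun a b => a * antipode b) (comul h) = (counit h : k)%:A }.

Record comodule (k : fieldType) (H : hopfAlgebra k) := Comodule {
  comod_sort :> lmodType k;
  coact : linhom comod_sort (comod_sort ⊗ H);
  coactA : forall v,
    tassoc (tmap coact (idhom H) (coact v)) =
    tmap (idhom comod_sort) (comul H) (coact v);
  coact_counit : forall v,
    tlift (fun v h => (counit H h : k) *: v) (coact v) = v }.

Section Sweedler.
Variables (k : fieldType) (H : hopfAlgebra k).
Implicit Types X : lmodType k.
Notation D := (comul H).
Notation S := (antipode H).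
Notation e := (counit H).

Definition trilin (U V W X : lmodType k) (F : U -> V -> W -> X) :=
  [/\ (forall v w, linear (fun u => F u v w)),
      (forall u w, linear (fun v => F u v w)) &
      (forall u v, linear (fun w => F u v w)) ].

Lemma tassoc_sw (U V W X : lmodType k) (F : U -> V -> W -> X) 
  (x : (U ⊗ V) ⊗ W) : trilin F ->
  tlift (fun u y => tlift (F u) y) (tassoc x) =
  tlift (fun y w => tlift (fun u v => F u v w) y) x.
Proof.
move=> [F1 F2 F3].
rewrite /tassoc tlift_push; last first.
  apply: tlift_linear; split=> [y|u]; last by apply: tlift_linear; split.
  by apply: lin_tlift_par.
apply: eq_tlift => y w; rewrite tlift_push; last first.
  apply: tlift_linear; split=> [z|u]; last by apply: tlift_linear; split.
  by apply: lin_tlift_par.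
apply: eq_tlift => u v; rewrite tliftE; first by rewrite tliftE //; split.
split=> [z|z]; last by apply: tlift_linear; split.
by apply: lin_tlift_par.
Qed.

Lemma coactA_sw (V : comodule H) X (F : V -> H -> H -> X) v : trilin F ->
  tlift (fun y c => tlift (fun a b => F a b c) (coact V y)) (coact V v) =
  tlift (fun a y => tlift (F a) (D y)) (coact V v).
Proof.
move=> tF; have [F1 F2 F3] := tF.
have := congr1 (tlift (fun u y => tlift (F u) y)) (coactA v).
have bF : bilin (fun u y => tlift (F u) y).
  split=> [y|u]; last by apply: tlift_linear; split.
  by apply: lin_tlift_par.
have bF2 w : bilin (fun u v => F u v w) by split.
rewrite tassoc_sw // !tlift_tmap //; split=> [w|y]; first exact: tlift_linear.
by apply: lin_tlift_par.
Qed.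

Lemma comulA_sw X (F : H -> H -> H -> X) h : trilin F ->
  tlift (fun y c => tlift (fun a b => F a b c) (D y)) (D h) =
  tlift (fun a y => tlift (F a) (D y)) (D h).
Proof.
move=> tF; have [F1 F2 F3] := tF.
have := congr1 (tlift (fun u y => tlift (F u) y)) (comulA h).
have bF : bilin (fun u y => tlift (F u) y).
  split=> [y|u]; last by apply: tlift_linear; split.
  by apply: lin_tlift_par.
have bF2 w : bilin (fun u v => F u v w) by split.
rewrite tassoc_sw // !tlift_tmap //; split=> [w|y]; first exact: tlift_linear.
by apply: lin_tlift_par.
Qed.

Lemma counitl_sw X (F : H -> X) h : linear F ->
  tlift (fun a b => (e a : k) *: F b) (D h) = F h.
Proof.
move=> lF; rewrite -[RHS]/(mkhom lF h) -{2}(counitl h) tlift_push; last lin.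
by apply: eq_tlift => u v; rewrite linearZ.
Qed.

Lemma counitr_sw X (F : H -> X) h : linear F ->
  tlift (fun a b => (e b : k) *: F a) (D h) = F h.
Proof.
move=> lF; rewrite -[RHS]/(mkhom lF h) -{2}(counitr h) tlift_push; last lin.
by apply: eq_tlift => u v; rewrite linearZ.
Qed.

Lemma coact_counit_sw (V : comodule H) X (F : V -> X) v : linear F ->
  tlift (fun a b => (e b : k) *: F a) (coact V v) = F v.
Proof.
move=> lF; rewrite -[RHS]/(mkhom lF v) -{2}(coact_counit v) tlift_push; last lin.
by apply: eq_tlift => u w; rewrite linearZ.
Qed.

Lemma antipodel_sw X (F : H -> X) h : linear F ->
  tlift (fun a b => F (S a * b)) (D h) = (e h : k) *: F 1.
Proof.
move=> lF; rewrite -[RHS](linearZ_LR (mkhom lF)) -antipodel.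
by rewrite -(tlift_push (f := mkhom lF)) //; lin.
Qed.

Lemma antipoder_sw X (F : H -> X) h : linear F ->
  tlift (fun a b => F (a * S b)) (D h) = (e h : k) *: F 1.
Proof.
move=> lF; rewrite -[RHS](linearZ_LR (mkhom lF)) -antipoder.
by rewrite -(tlift_push (f := mkhom lF)) //; lin.
Qed.

Lemma comulM_sw X (F : H -> H -> X) g h : bilin F ->
  tlift F (D (g * h)) =
  tlift (fun a b => tlift (fun a' b' => F (a * a') (b * b')) (D h)) (D g).
Proof.
move=> bF; rewrite comulM /tmul tlift_push; last exact: tlift_linear.
apply: eq_tlift => a b; rewrite tlift_push; last exact: tlift_linear.
by apply: eq_tlift => a' b'; rewrite tliftE.
Qed.

Definition rcomul h : H ⊗ H := tlift (fun a b => S b ⊗t S a) (D h).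

Lemma rcomul_linear : linear rcomul.
Proof. rewrite /rcomul; lin. Qed.

Lemma comul_rcomul h :
  tlift (fun a b => tmul (D a) (rcomul b)) (D h) =
  (e h : k) *: ((1 : H) ⊗t (1 : H)).
Proof.
under eq_tlift => a b do rewrite /tmul.
rewrite comulA_sw; last first.
  split; rewrite /rcomul; lin.
rewrite -[RHS](antipoder_sw (F := fun x => x ⊗t 1)); last lin.
apply: eq_tlift => b1 x.
transitivity (tlift (fun b2 c => tlift (fun c1 c2 => 
   (b1 * S c2) ⊗t (b2 * S c1)) (D c)) (D x)).
  apply: eq_tlift => b2 c; rewrite /rcomul tlift_push; last lin.
  by apply: eq_tlift => c1 c2; rewrite tliftE //; lin.
rewrite -comulA_sw; last by split; lin.
rewrite -[RHS](counitl_sw (F := fun x => (b1 * S x) ⊗t 1)); last lin.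
apply: eq_tlift => z c2.
by rewrite (antipoder_sw (F := fun x => (b1 * S c2) ⊗t x)) //; lin.
Qed.

Lemma comul_antipode h : D (S h) = rcomul h.
Proof.
pose R := mkhom rcomul_linear.
transitivity (tlift (fun a y => tlift (fun b c =>
    tmul (D (S a)) (tmul (D b) (R c))) (D y)) (D h)).
  rewrite -[LHS](counitr_sw (F := fun x => D (S x))); last lin.
  apply: eq_tlift => a y; rewrite -tlift_push; last lin.
  by rewrite comul_rcomul linZ ?tmulx1 //; lin.
rewrite -comulA_sw; last by split; lin.
rewrite -[RHS](counitl_sw (F := R)); last lin.
apply: eq_tlift => y c.
under eq_tlift => a b do rewrite tmulA -comulM.
rewrite (antipodel_sw (F := fun x => tmul (D x) (R c))); last lin.
by rewrite comul1 tmul1x.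
Qed.

Lemma comul_antipode_sw X (F : H -> H -> X) h : bilin F ->
  tlift F (D (S h)) = tlift (fun a b => F (S b) (S a)) (D h).
Proof.
move=> bF; rewrite comul_antipode /rcomul tlift_push; last exact: tlift_linear.
by apply: eq_tlift => a b; rewrite tliftE.
Qed.

Lemma counit_antipode h : e (S h) = e h.
Proof.
have := congr1 e (antipodel h); rewrite tlift_push; last lin.
under eq_tlift => a b do rewrite counitM mulrC.
rewrite (counitr_sw (F := fun x => e (S x))); last lin.
by move=> ->; rewrite linearZ /= counit1; apply: mulr1.
Qed.

End Sweedler.

Section Separation.
Variables (k : fieldType).

Lemma separate (X : lmodType k) (N : X -> Prop) (h : X) :
  N 0 -> (forall a x y, N x -> N y -> N (a *: x + y)) -> ~ N h ->
  exists phi : linhom X k^o, (forall x, N x -> phi x = 0) /\ phi h = 1.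
Proof.
move=> N0 NP Nh.
pose sub (A : set X) := [/\ forall x, N x -> A x,
  forall a x y, A x -> A y -> A (a *: x + y) & ~ A h].
have [M [[M0|[NM MP Mh]] Mmax]] : exists A, (A = set0 \/ sub A) /\
    forall B, (A `<` B)%classic -> ~ (B = set0 \/ sub B).
  apply: Zorn_bigcup => F Fsub Ftot.
  have [[A0 [FA0 [x0 A0x0]]]|F0] :=
    pselect (exists A, F A /\ exists x, A x); last first.
    left; apply/seteqP; split=> // x [A FA Ax]; apply: F0.
    by exists A; split=> //; exists x.
  right.
  have Fs A x : F A -> A x -> sub A.
    by move=> FA Ax; have [A0'|//] := Fsub _ FA; rewrite A0' in Ax.
  split.
  - by move=> x Nx; exists A0 => //; have [NA _ _] := Fs _ _ FA0 A0x0; apply: NA.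
  - move=> a x y [A FA Ax] [B FB By].
    have [AB|BA] := Ftot _ _ FA FB.
      exists B => //; have [_ BP _] := Fs _ _ FB By; apply: BP => //.
      exact: AB.
    exists A => //; have [_ AP _] := Fs _ _ FA Ax; apply: AP => //.
    exact: BA.
  - by move=> [A FA Ah]; have [_ _] := Fs _ _ FA Ah; apply.
- exfalso; apply: (Mmax [set x | N x]%classic); last by right; split.
  by rewrite M0; split=> // /(_ 0 N0).
have M0 : M 0 by apply: NM.
have dec x : exists c, M (x - c *: h).
  have [Mx|Mx] := pselect (M x); first by exists 0; rewrite scale0r subr0.
  have [[c [m [Mm hE]]]|nex] := pselect (exists c m, M m /\ h = c *: x + m).
    have c0 : c != 0.
      by apply/eqP => c0; apply: Mh; rewrite hE c0 scale0r add0r.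
    exists c^-1; rewrite hE scalerDr scalerA mulVf // scale1r opprD addNKr.
    by rewrite -[- _]addr0 -scaleNr; apply: MP.
  exfalso; apply: (Mmax [set y | exists c m, M m /\ y = c *: x + m]%classic).
    split=> [m Mm|/(_ x) sM]; first by exists 0, m; rewrite scale0r add0r.
    by apply/Mx/sM; exists 1, 0; rewrite scale1r addr0.
  right; split.
  - by move=> m /NM Mm; exists 0, m; rewrite scale0r add0r.
  - move=> a _ _ [c [m [Mm ->]]] [c' [m' [Mm' ->]]].
    exists (a * c + c'), (a *: m + m'); split; first exact: MP.
    by rewrite scalerDr scalerDl scalerA addrACA.
  - by move=> [c [m [Mm hE]]]; apply: nex; exists c, m.
have uniq x c d : M (x - c *: h) -> M (x - d *: h) -> c = d.
  move=> Mc Md; apply/eqP; rewrite -subr_eq0; apply/negPn/negP => cd0.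
  apply: Mh; have : M ((c - d) *: h).
    have := MP (-1) _ _ Mc Md; rewrite scaleN1r opprB addrA subrK.
    by rewrite -scalerBl.
  move=> /(fun z => MP (c - d)^-1 _ _ z M0).
  by rewrite addr0 scalerA mulVf // scale1r.
pose phi x : k^o := projT1 (cid (dec x)).
have phiM x : M (x - (phi x : k) *: h) by apply: (projT2 (cid (dec x))).
have phil : linear phi.
  move=> a x y; apply: (uniq (a *: x + y)) => //.
  have := MP a _ _ (phiM x) (phiM y).
  by rewrite scalerBr scalerDl opprD addrACA scalerA.
exists (mkhom phil); split=> [x Nx|] /=.
  by apply: (uniq x) => //; rewrite scale0r subr0; apply: NM.
by apply: (uniq h) => //; rewrite scale1r subrr.
Qed.

Definition slice (A X : lmodType k) (phi : linhom X k^o) (t : A ⊗ X) : A :=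
  tlift (fun a x => (phi x : k) *: a) t.

Lemma sliceE (A X : lmodType k) (phi : linhom X k^o) (a : A) (x : X) :
  slice phi (a ⊗t x) = (phi x : k) *: a.
Proof. by rewrite /slice tliftE //; lin. Qed.

Lemma slice_linear (A X : lmodType k) (phi : linhom X k^o) :
  linear (@slice A X phi).
Proof. rewrite /slice; lin. Qed.

Definition slice_hom (A X : lmodType k) (phi : linhom X k^o) : linhom (A ⊗ X) A :=
  mkhom (@slice_linear A X phi).

Lemma slices_in (A X : lmodType k) (N : A -> Prop) (t : A ⊗ X) :
  (forall phi, N (slice phi t)) -> N 0 ->
  (forall a x y, N x -> N y -> N (a *: x + y)) ->
  exists2 s : seq (A * X), (forall p, p \in s -> N p.1) &
    t = \sum_(p <- s) p.1 ⊗t p.2.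
Proof.
move=> Nt N0 NP; rewrite [t]tensor_sum in Nt *.
move: (trepr t) Nt => s; have [n] := ubnP (size s).
elim: n s => // n IH [|[a h] s] /= sn Nt; first by exists [::].
pose c2 i := (nth (0, 0) s i).2; pose c1 i := (nth (0, 0) s i).1.
have sE : \sum_(p <- s) p.1 ⊗t p.2 = \sum_(i < size s) c1 i ⊗t c2 i.
  by rewrite (big_nth (0, 0)) big_mkord.
pose span x := exists c : nat -> k, x = \sum_(i < size s) c i *: c2 i.
have [[c hE]|nspan] := pselect (span h).
  pose s' := [seq (c1 i + c i *: a, c2 i) | i <- index_iota 0 (size s)].
  have ss' : \sum_(p <- (a, h) :: s) p.1 ⊗t p.2 = \sum_(p <- s') p.1 ⊗t p.2.
    rewrite big_cons sE /s' big_map.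
    rewrite big_mkord /= [in LHS]hE -[a ⊗t _]/(mkhom (tens_linearr a) _).
    rewrite linear_sum -big_split; apply: eq_bigr => i _ /=.
    rewrite addrC -[(c1 i + _) ⊗t _]/(mkhom (tens_linearl (c2 i)) _).
    by rewrite linearD !linearZ /= -[_ ⊗t (c i *: _)]/(mkhom (tens_linearr a) _)
      linearZ.
  rewrite ss' in Nt *; apply: IH => //; by rewrite size_map size_iota subn0.
have spanP b x y : span x -> span y -> span (b *: x + y).
  move=> [c ->] [d ->]; exists (fun i => b * c i + d i).
  rewrite scaler_sumr -big_split /=; apply: eq_bigr => i _.
  by rewrite scalerDl scalerA.
have span0 : span 0.
  by exists (fun _ => 0); rewrite big1 // => i _; rewrite scale0r.
have [phi [phi0 phi1]] := separate span0 spanP nspan.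
have spans (i : 'I_(size s)) : span (c2 i).
  exists (fun j => (j == i :> nat)%:R); rewrite (bigD1 i) //= eqxx scale1r.
  by rewrite big1 ?addr0 // => j /negPf ji; rewrite -val_eqE in ji;
    rewrite ji scale0r.
have slice_cons psi : slice psi (\sum_(p <- (a, h) :: s) p.1 ⊗t p.2) =
    (psi h : k) *: a + slice psi (\sum_(p <- s) p.1 ⊗t p.2).
  by rewrite big_cons -[slice psi _]/(slice_hom A psi _) linearD /= sliceE.
have Na : N a.
  have := Nt phi; rewrite slice_cons phi1 scale1r sE.
  rewrite -[slice phi _]/(slice_hom A phi _) linear_sum big1 ?addr0 //.
  by move=> i _ /=; rewrite sliceE phi0 // scale0r.
have [||s' Ns' s'E] := IH s; first by [].
  move=> psi; have := NP (- psi h) _ _ Na (Nt psi).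
  by rewrite slice_cons scaleNr addKr.
exists ((a, h) :: s'); last by rewrite !big_cons s'E.
by move=> p; rewrite inE => /predU1P[->|/Ns'].
Qed.

Lemma slices0 (A X : lmodType k) (t : A ⊗ X) :
  (forall phi, slice phi t = 0) -> t = 0.
Proof.
move=> t0; have [//||s s0 ->] := @slices_in A X (fun a => a = 0) t t0.
  by move=> a x y -> ->; rewrite scaler0 addr0.
rewrite big_seq big1 // => p /s0 ->.
by rewrite -[_ ⊗t _]/(mkhom (tens_linearl p.2) _) linear0.
Qed.

End Separation.

Lemma mkhomE (k : fieldType) (U V : lmodType k) (f : U -> V) (fl : linear f) x :
  mkhom fl x = f x.
Proof. by []. Qed.

Lemma tassoc_linear (k : fieldType) (U V W : lmodType k) :
  linear (@tassoc k U V W).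
Proof. rewrite /tassoc; lin. Qed.

Lemma tassocE (k : fieldType) (U V W : lmodType k) (x : U ⊗ V) (w : W) :
  tassoc (x ⊗t w) = tlift (fun u v => u ⊗t (v ⊗t w)) x.
Proof. by rewrite /tassoc tliftE //; lin. Qed.

Section TensorComodule.
Variables (k : fieldType) (H : hopfAlgebra k) (T W : comodule H).

Definition tensor_coact_fun : T ⊗ W -> (T ⊗ W) ⊗ H :=
  tlift (fun t w =>
    tlift (fun t0 t1 =>
      tlift (fun w0 w1 => (t0 ⊗t w0) ⊗t (t1 * w1)) (coact W w)) (coact T t)).

Lemma tensor_coact_linear : linear tensor_coact_fun.
Proof. rewrite /tensor_coact_fun; lin. Qed.

Definition tensor_coact : linhom (T ⊗ W) ((T ⊗ W) ⊗ H) :=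
  mkhom tensor_coact_linear.

Lemma tensor_coactE t w : tensor_coact (t ⊗t w) =
  tlift (fun t0 t1 =>
    tlift (fun w0 w1 => (t0 ⊗t w0) ⊗t (t1 * w1)) (coact W w)) (coact T t).
Proof. by rewrite /= /tensor_coact_fun tliftE //; lin. Qed.

Lemma tensor_coactA x :
  tassoc (tmap tensor_coact (idhom H) (tensor_coact x)) =
  tmap (idhom (T ⊗ W)) (comul H) (tensor_coact x).
Proof.
move: x; apply: tensor_ext => [||t w].
- by move=> a x y; rewrite linearP tmap_linear tassoc_linear.
- by move=> a x y; rewrite linearP tmap_linear.
rewrite tensor_coactE.
rewrite (tlift_push _ _ (tmap_linear _ _))
  (tlift_push _ _ (@tassoc_linear _ _ _ _)).
rewrite [RHS](tlift_push _ _ (tmap_linear _ _)).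
transitivity (tlift (fun t0 t1 => tlift (fun t00 t01 =>
   tlift (fun w0 w1 => tlift (fun w00 w01 =>
      (t00 ⊗t w00) ⊗t ((t01 * w01) ⊗t (t1 * w1))) (coact W w0)) (coact W w))
   (coact T t0)) (coact T t)).
  apply: eq_tlift => t0 t1.
  rewrite (tlift_push _ _ (tmap_linear _ _))
  (tlift_push _ _ (@tassoc_linear _ _ _ _)).
  rewrite [RHS]tlift_exchange; apply: eq_tlift => w0 w1.
  rewrite tmapE tensor_coactE tassocE tlift_push; last lin.
  apply: eq_tlift => t00 t01; rewrite tlift_push; last lin.
  by apply: eq_tlift => w00 w01; rewrite tliftE //; lin.
rewrite coactA_sw; last by split; lin.
apply: eq_tlift => t0 t1.
rewrite (tlift_push _ _ (tmap_linear _ _)).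
under [RHS]eq_tlift => w0 w1 do rewrite tmapE comulM /tmul.
rewrite (eq_tlift (b' := fun t2 t3 => tlift (fun w0 y => tlift (fun w1 w2 =>
  (t0 ⊗t w0) ⊗t ((t2 * w1) ⊗t (t3 * w2))) (comul H y)) (coact W w)));
  last by move=> t2 t3; rewrite coactA_sw //; split; lin.
rewrite tlift_exchange; apply: eq_tlift => w0 w1.
rewrite [RHS](tlift_push (f := tens _)); last lin.
apply: eq_tlift => a b; rewrite [RHS](tlift_push (f := tens _)) //; lin.
Qed.

Lemma tensor_coact_counit x :
  tlift (fun v h => (counit H h : k) *: v) (tensor_coact x) = x.
Proof.
move: x; apply: tensor_ext => [||t w]; [lin|lin|].
rewrite tensor_coactE tlift_push; last lin.
rewrite -[RHS](coact_counit_sw (F := fun t => t ⊗t w)); last lin.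
apply: eq_tlift => t0 t1.
rewrite tlift_push; last lin.
rewrite -(coact_counit_sw (F := fun w => t0 ⊗t w) w); last lin.
rewrite [RHS](tlift_push (f := fun z => (counit H t1 : k) *: z)); last lin.
apply: eq_tlift => w0 w1.
by rewrite tliftE; [rewrite counitM scalerA|lin].
Qed.

Definition tensor_comod : comodule H :=
  Comodule tensor_coactA tensor_coact_counit.
End TensorComodule.

Notation "T ⊗c W" := (tensor_comod T W) (at level 40, left associativity).

Section ComoduleMaps.
Variables (k : fieldType) (H : hopfAlgebra k) (M N : comodule H).

Definition comod_pred : {pred linhom M N} :=
  [pred f : linhom M N | `[< forall m,
     coact N (f m) = tmap f (idhom H) (coact M m) >]].

Record comod_hom := ComodHom {
  comod_hom_val :> linhom M N; _ : comod_hom_val \in comod_pred }.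

HB.instance Definition _ := [isSub for comod_hom_val].
HB.instance Definition _ := [Choice of comod_hom by <:].

Lemma comod_pred_closed : subsemimod_closed comod_pred.
Proof.
split.
  split.
    apply/asboolP => m; rewrite -[(0 : linhom M N) m]/(0 : N) linear0.
    apply/esym; rewrite /tmap /tlift big1 // => p _.
    by rewrite -[(0 : linhom M N) _]/(0 : N)
      -[_ ⊗t _]/(mkhom (tens_linearl _) _) linear0.
  move=> f g /asboolP fP /asboolP gP; apply/asboolP => m.
  rewrite homDE linearD /= fP gP /tmap /tlift -big_split; apply: eq_bigr => p _.
  exact: esym (linearD (mkhom (tens_linearl p.2)) (f p.1) (g p.1)).
move=> c f /asboolP fP; apply/asboolP => m.
rewrite homZE linearZ /= fP /tmap /tlift scaler_sumr; apply: eq_bigr => p _.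
exact: esym (linearZ_LR (mkhom (tens_linearl p.2)) c (f p.1)).
Qed.

HB.instance Definition _ :=
  GRing.SubChoice_isSubLmodule.Build k (linhom M N) comod_pred comod_hom
    comod_pred_closed.

Lemma comod_homP (f : comod_hom) m :
  coact N (f m) = tmap f (idhom H) (coact M m).
Proof. by case: f => f /= /asboolP. Qed.

Definition mkcomod (f : linhom M N)
    (fP : forall m, coact N (f m) = tmap f (idhom H) (coact M m)) :
  comod_hom := ComodHom (asboolT fP).

Lemma comod_hom_eq (f g : comod_hom) : f =1 g -> f = g.
Proof. by move=> fg; apply/val_inj/homP. Qed.

Lemma coact_sw (f : comod_hom) m (X : lmodType k) (F : N -> H -> X) : bilin F ->
  tlift F (coact N (f m)) = tlift (fun a b => F (f a) b) (coact M m).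
Proof. by move=> bF; rewrite comod_homP tlift_tmap. Qed.
End ComoduleMaps.

Section ComoduleCategory.
Variables (k : fieldType) (H : hopfAlgebra k).
Implicit Types M N P : comodule H.

Lemma comod_comp_proof M N P (g : comod_hom N P) (f : comod_hom M N) m :
  coact P (comp_hom g f m) = tmap (comp_hom g f) (idhom H) (coact M m).
Proof. by rewrite [LHS]comod_homP comod_homP /tmap tlift_tmap //; lin. Qed.

Definition comod_comp M N P (g : comod_hom N P) (f : comod_hom M N) :
  comod_hom M P := mkcomod (comod_comp_proof g f).

Lemma tmap_comod_proof M M' N N' (f : comod_hom M M') (g : comod_hom N N') x :
  coact (M' ⊗c N') (mkhom (tmap_linear f g) x) =
  tmap (mkhom (tmap_linear f g)) (idhom H) (coact (M ⊗c N) x).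
Proof.
move: x; apply: tensor_ext => [||m n].
- lin.
- by move=> a x y; rewrite linearP tmap_linear.
rewrite mkhomE tmapE !tensor_coactE coact_sw; last lin.
rewrite (tlift_push _ _ (tmap_linear _ _)); apply: eq_tlift => m0 m1.
rewrite (tlift_push _ _ (tmap_linear _ _)) coact_sw; last lin.
by apply: eq_tlift => n0 n1; rewrite tmapE mkhomE tmapE.
Qed.

Definition comod_tmap M M' N N' (f : comod_hom M M') (g : comod_hom N N') :
  comod_hom (M ⊗c N) (M' ⊗c N') :=
  @mkcomod k H (M ⊗c N) (M' ⊗c N') (mkhom (tmap_linear f g))
    (tmap_comod_proof f g).
End ComoduleCategory.

Notation "g ∘c f" := (comod_comp g f) (at level 50, left associativity).

Section HomTens.
Variables (k : fieldType) (W V X : lmodType k).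

(* The canonical embedding of Hom(W, V) ⊗ X in Hom(W, V ⊗ X); see
   hom_tens_inj. *)
Definition hom_tens_fun (t : linhom W V ⊗ X) (w : W) : V ⊗ X :=
  tlift (fun (f : linhom W V) x => f w ⊗t x) t.

Lemma hom_tens_subproof t : linear (hom_tens_fun t).
Proof. rewrite /hom_tens_fun; lin. Qed.

Definition hom_tens t : linhom W (V ⊗ X) := mkhom (hom_tens_subproof t).

Lemma hom_tensE t w : hom_tens t w = tlift (fun (f : linhom W V) x => f w ⊗t x) t.
Proof. by []. Qed.

Lemma slice_hom_tens phi (t : linhom W V ⊗ X) w :
  (slice phi t : linhom W V) w = slice phi (hom_tens t w).
Proof.
rewrite {1}/slice (tlift_push (f := fun g : linhom W V => g w)); last lin.
rewrite /= /hom_tens_fun tlift_push; last exact: slice_linear.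
by apply: eq_tlift => f x; rewrite sliceE.
Qed.

Lemma hom_tens_linear : linear hom_tens.
Proof.
by move=> a s t; apply: homP => w; rewrite /= /hom_tens_fun tlift_linear //; lin.
Qed.

Lemma hom_tens_inj : injective hom_tens.
Proof.
move=> s t st; apply/subr0_eq/slices0 => phi; apply: homP => w.
have st0 : hom_tens (s - t) = 0.
  rewrite -[hom_tens]/(hom_fun (mkhom hom_tens_linear)) linearB.
  by apply/eqP; rewrite subr_eq0; apply/eqP.
by rewrite slice_hom_tens st0 -[slice _]/(hom_fun (slice_hom _ phi)) linear0.
Qed.
End HomTens.

Section TmapInj.
Variables (k : fieldType) (A B X : lmodType k) (i : linhom A B).
Lemma tmap_inj : injective i -> injective (tmap i (idhom X)).
Proof.
move=> ii s t st; apply/subr0_eq/slices0 => phi; apply: ii; rewrite linear0.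
rewrite /slice tlift_push; last lin.
transitivity (slice phi (tmap i (idhom X) (s - t))).
  rewrite /slice tlift_tmap; last lin.
  by apply: eq_tlift => a x; rewrite linearZ.
have -> : tmap i (idhom X) (s - t) = 0.
  rewrite -[tmap i _]/(hom_fun (mkhom (tmap_linear i (idhom X)))) linearB.
  by apply/eqP; rewrite subr_eq0; apply/eqP.
by rewrite -[slice _]/(hom_fun (slice_hom _ phi)) linear0.
Qed.
End TmapInj.

Section Homl.
Variables (k : fieldType) (H : hopfAlgebra k) (W V : comodule H).
Notation D := (comul H).
Notation S := (antipode H).

Definition rho_fun (f : linhom W V) (w : W) : V ⊗ H :=
  tlift (fun w0 w1 => tlift (fun v0 v1 => v0 ⊗t (v1 * S w1)) (coact V (f w0)))
    (coact W w).

Lemma rho_fun_linear f : linear (rho_fun f).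
Proof. rewrite /rho_fun; lin. Qed.

Definition rho f : linhom W (V ⊗ H) := mkhom (rho_fun_linear f).

Lemma rho_linear : linear rho.
Proof.
move=> a f g; apply: homP => w.
have rl : linear (fun f => rho_fun f w) by rewrite /rho_fun; lin.
exact: rl.
Qed.

Definition homl_pred : {pred linhom W V} :=
  [pred f | `[< exists t : linhom W V ⊗ H, hom_tens t = rho f >]].

Record homl := Homl { homl_val :> linhom W V; _ : homl_val \in homl_pred }.

HB.instance Definition _ := [isSub for homl_val].
HB.instance Definition _ := [Choice of homl by <:].

Lemma homl_predP f : reflect (exists t : linhom W V ⊗ H, hom_tens t = rho f)
  (f \in homl_pred).
Proof. exact: asboolP. Qed.

Lemma homl_pred_lin a f g :
  f \in homl_pred -> g \in homl_pred -> a *: f + g \in homl_pred.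
Proof.
move=> /homl_predP[s sf] /homl_predP[t tg]; apply/homl_predP.
by exists (a *: s + t); rewrite hom_tens_linear sf tg rho_linear.
Qed.

Lemma homl_pred0 : 0 \in homl_pred.
Proof.
apply/homl_predP; exists 0.
rewrite -[rho]/(hom_fun (mkhom rho_linear)).
by rewrite -[@hom_tens _ _ _ _]/(hom_fun (mkhom (@hom_tens_linear k W V H)))
  !linear0.
Qed.

Lemma homl_pred_closed : subsemimod_closed homl_pred.
Proof.
split; first split; first exact: homl_pred0.
  by move=> f g fP gP; rewrite -[f]scale1r; apply: homl_pred_lin.
by move=> a f fP; rewrite -[_ *: _]addr0; apply: homl_pred_lin homl_pred0.
Qed.

HB.instance Definition _ :=
  GRing.SubChoice_isSubLmodule.Build k (linhom W V) homl_pred homl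
    homl_pred_closed.

Lemma homl_val_linear : linear homl_val.
Proof. by []. Qed.

Definition homl_incl : linhom homl (linhom W V) := mkhom homl_val_linear.

Lemma homl_incl_inj : injective homl_incl.
Proof. exact: val_inj. Qed.

Lemma rhoE (X : lmodType k) (F : V -> H -> X) f w : bilin F ->
  tlift F (rho f w) = tlift (fun w0 w1 =>
    tlift (fun v0 v1 => F v0 (v1 * S w1)) (coact V (f w0))) (coact W w).
Proof.
move=> bF; rewrite /= /rho_fun tlift_push; last exact: tlift_linear.
apply: eq_tlift => w0 w1; rewrite tlift_push; last exact: tlift_linear.
by apply: eq_tlift => v0 v1; rewrite tliftE.
Qed.

Lemma rhoA f w :
  tlift (fun w0 w1 => tlift (fun v c =>
     tlift (fun v0 v1 => v0 ⊗t ((v1 * S w1) ⊗t c)) (coact V v)) (rho f w0))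
     (coact W w) =
  tmap (idhom V) D (rho f w).
Proof.
transitivity (tlift (fun w0 w1 => tlift (fun w00 w01 =>
    tlift (fun v y => tlift (fun v1 v2 => 
      v ⊗t ((v1 * S w1) ⊗t (v2 * S w01))) (D y)) (coact V (f w00)))
   (coact W w0)) (coact W w)).
  apply: eq_tlift => w0 w1; rewrite rhoE; last lin.
  apply: eq_tlift => w00 w01.
  by rewrite coactA_sw //; split; lin.
rewrite coactA_sw; last by split; lin.
rewrite /tmap rhoE; last lin.
apply: eq_tlift => w0 w1; rewrite tlift_exchange; apply: eq_tlift => v0 v1 /=.
rewrite -[D (v1 * _)]tlift_tens comulM_sw; last lin.
rewrite [RHS](tlift_push (f := tens v0)); last lin.
rewrite tlift_exchange; apply: eq_tlift => a b.
rewrite comul_antipode_sw; last lin.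
by rewrite [RHS](tlift_push (f := tens v0)) //; lin.
Qed.

Lemma rho_slice (f : linhom W V) (t : linhom W V ⊗ H) phi :
  hom_tens t = rho f -> slice phi t \in homl_pred.
Proof.
move=> tf; apply/homl_predP.
exists (tlift (fun g h => tlift (fun a b => (phi b : k) *: (g ⊗t a)) (D h)) t).
apply: homP => w /=.
pose G := tlift (fun (v : V) y =>
  tlift (fun b c : H => (phi c : k) *: (v ⊗t b)) y).
transitivity (G (tmap (idhom V) D (rho f w))).
  rewrite -tf /G tlift_tmap; last lin.
  rewrite /= /hom_tens_fun tlift_push; last lin.
  rewrite [RHS]tlift_push; last lin.
  apply: eq_tlift => g h; rewrite tliftE; last lin.
  rewrite tlift_push; last lin.
  by apply: eq_tlift => a b; rewrite linZ ?tliftE //; lin.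
rewrite -rhoA /G tlift_push; last lin.
rewrite /rho_fun; apply: eq_tlift => w0 w1.
rewrite slice_hom_tens tf; move: (rho f w0).
apply: tensor_ext => [||v h]; [lin|rewrite /slice; lin|].
rewrite sliceE tliftE; last lin.
rewrite [RHS](linZ (f := fun z => tlift _ (coact V z))); last lin.
rewrite [RHS](tlift_push (f := fun z => (phi h : k) *: z)); last lin.
rewrite tlift_push; last lin.
by apply: eq_tlift => v0 v1; rewrite !tliftE //; lin.
Qed.

Lemma homl_coact_ex (f : homl) : exists t : homl ⊗ H,
  hom_tens (tmap homl_incl (idhom H) t) = rho f.
Proof.
have /homl_predP[t tf] : homl_val f \in homl_pred := valP f.
have [|||s sP tE] := @slices_in k _ _ (fun g => g \in homl_pred) t.
- by move=> phi; apply: rho_slice tf.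
- exact: homl_pred0.
- by move=> a x y; apply: homl_pred_lin.
exists (\sum_(p <- s) (insubd (0 : homl) p.1) ⊗t p.2).
rewrite -tf; congr hom_tens.
rewrite -[tmap _ _]/(hom_fun (mkhom (tmap_linear homl_incl (idhom H)))).
rewrite linear_sum tE big_seq [RHS]big_seq; apply: eq_bigr => p ps.
by rewrite [LHS]tmapE /= -[homl_val _]/(val _) insubdK // sP.
Qed.

(* The coaction of Hom^l(W, V) is rho, seen in Hom^l(W, V) ⊗ H through the
   embedding in Hom(W, V ⊗ H): it is the unique solution of homl_coact_funE. *)
Definition homl_coact_fun (f : homl) : homl ⊗ H :=
  projT1 (cid (homl_coact_ex f)).

Lemma homl_coact_funE f :
  hom_tens (tmap homl_incl (idhom H) (homl_coact_fun f)) = rho f.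
Proof. exact: (projT2 (cid (homl_coact_ex f))). Qed.

Lemma homl_tens_inj (X : lmodType k) (s t : homl ⊗ X) :
  (forall w, tlift (fun g x => homl_val g w ⊗t x) s =
             tlift (fun g x => homl_val g w ⊗t x) t) ->
  s = t.
Proof.
move=> st; apply: (tmap_inj homl_incl_inj).
apply: hom_tens_inj; apply: homP => w; rewrite !hom_tensE.
by rewrite !tlift_tmap //; try lin; apply: st.
Qed.

Lemma homl_coact_linear : linear homl_coact_fun.
Proof.
move=> a f g; apply: (tmap_inj homl_incl_inj); apply: hom_tens_inj.
rewrite tmap_linear hom_tens_linear !homl_coact_funE.
exact: rho_linear.
Qed.

Definition homl_coact : linhom homl (homl ⊗ H) := mkhom homl_coact_linear.

Lemma homl_coactE f w :
  tlift (fun g x => homl_val g w ⊗t x) (homl_coact f) = rho f w.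
Proof.
by rewrite -homl_coact_funE hom_tensE tlift_tmap //; lin.
Qed.

Lemma lin_homl (X : lmodType k) (g : X -> homl) w : linear g ->
  linear (fun x => homl_val (g x) w).
Proof. by move=> gl a x y; rewrite gl. Qed.

Lemma homl_coact_sw (X : lmodType k) (F : V -> H -> X) f w : bilin F ->
  tlift (fun g x => F (homl_val g w) x) (homl_coact f) = tlift F (rho f w).
Proof.
move=> bF; rewrite -homl_coactE tlift_push; last exact: tlift_linear.
by apply: eq_tlift => g x; rewrite tliftE.
Qed.

Lemma homl_coactA f :
  tassoc (tmap homl_coact (idhom H) (homl_coact f)) =
  tmap (idhom homl) D (homl_coact f).
Proof.
apply: homl_tens_inj => w.
have lw (g : homl -> homl) : linear g -> linear (fun x => homl_val (g x) w).
  exact: lin_homl.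
have bt (Y : lmodType k) : bilin (fun (g : homl) (x : Y) => homl_val g w ⊗t x).
  by split=> [v|u]; last lin; apply: lin_tensl; apply: lw (@lin_id _ _).
rewrite [RHS]tlift_tmap /=; last exact: bt.
rewrite (homl_coact_sw (F := fun v h => v ⊗t D h)); last lin.
rewrite -[RHS]/(tmap (idhom V) D (rho f w)) -rhoA.
rewrite {1}/tmap.
rewrite (tlift_push (f := @tassoc _ _ _ _)); last exact: tassoc_linear.
rewrite [LHS](tlift_push (f := tlift (fun g x => homl_val g w ⊗t x)));
  last exact: tlift_linear.
transitivity (tlift (fun g h =>
    tlift (fun v h' => v ⊗t (h' ⊗t h)) (rho (homl_val g) w)) (homl_coact f)).
  apply: eq_tlift => g h.
  rewrite tassocE.
  rewrite (tlift_push (f := tlift (fun g x => homl_val g w ⊗t x)));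
    last exact: tlift_linear.
  rewrite -homl_coact_sw; last lin.
  by apply: eq_tlift => g' h'; rewrite tliftE.
transitivity (tlift (fun g h => tlift (fun w0 w1 =>
    tlift (fun v0 v1 => v0 ⊗t ((v1 * S w1) ⊗t h)) (coact V (homl_val g w0)))
  (coact W w)) (homl_coact f)).
  by apply: eq_tlift => g h; rewrite rhoE //; lin.
rewrite tlift_exchange; apply: eq_tlift => w0 w1.
rewrite (homl_coact_sw (F := fun v h =>
  tlift (fun v0 v1 => v0 ⊗t ((v1 * S w1) ⊗t h)) (coact V v))) //; lin.
Qed.

Lemma homl_coact_counit f :
  tlift (fun g h => (counit H h : k) *: g) (homl_coact f) = f.
Proof.
apply/homl_incl_inj/homP => w.
rewrite (tlift_push (f := fun g => homl_incl g w)); last lin.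
transitivity (tlift (fun v h => (counit H h : k) *: v) (rho f w)).
  rewrite -homl_coact_sw; last lin.
  by apply: eq_tlift => g h; rewrite linearZ.
rewrite rhoE; last lin.
rewrite -[RHS](coact_counit_sw (F := fun w => homl_val f w)); last lin.
apply: eq_tlift => w0 w1.
rewrite -[in RHS](coact_counit (homl_val f w0))
  [RHS](tlift_push (f := fun z => (counit H w1 : k) *: z)); last lin.
by apply: eq_tlift => v0 v1; rewrite counitM counit_antipode mulrC scalerA.
Qed.

Definition homl_comod : comodule H := Comodule homl_coactA homl_coact_counit.
End Homl.

Section HomlFunctor.
Variables (k : fieldType) (H : hopfAlgebra k) (W W' V V' : comodule H).
Variables (b : comod_hom W' W) (c : comod_hom V V').

Lemma rho_comp (f : linhom W V) w :
  rho (comp_hom c (comp_hom f b)) w = tmap c (idhom H) (rho f (b w)).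
Proof.
rewrite /tmap rhoE; last lin.
rewrite coact_sw; last lin.
rewrite /= /rho_fun; apply: eq_tlift => w0 w1 /=.
by rewrite coact_sw //; lin.
Qed.

Lemma conj_linear : linear (fun f : linhom W V => comp_hom c (comp_hom f b)).
Proof. by move=> a f g; apply: homP => w /=; rewrite linearP. Qed.

Definition conj_hom : linhom (linhom W V) (linhom W' V') := mkhom conj_linear.

Lemma homl_map_subproof (f : homl W V) :
  conj_hom f \in @homl_pred _ _ W' V'.
Proof.
have /homl_predP[t tf] : homl_val f \in @homl_pred _ _ W V := valP f.
apply/homl_predP; exists (tmap conj_hom (idhom H) t).
apply: homP => w; rewrite rho_comp -tf !hom_tensE tlift_tmap; last lin.
rewrite /tmap tlift_push; last lin.
by apply: eq_tlift => g x; rewrite tliftE //; lin.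
Qed.

(* f |-> c ∘ f ∘ b *)
Definition homl_map_fun (f : homl W V) : homl W' V' :=
  Homl (homl_map_subproof f).

Lemma homl_map_linear : linear homl_map_fun.
Proof. by move=> a f g; apply: val_inj; apply: conj_linear. Qed.

Lemma homl_map_comod f :
  coact (homl_comod W' V') (mkhom homl_map_linear f) =
  tmap (mkhom homl_map_linear) (idhom H) (coact (homl_comod W V) f).
Proof.
apply: homl_tens_inj => w.
rewrite [LHS]homl_coactE [LHS]rho_comp /tmap -homl_coact_sw; last lin.
rewrite [RHS]tlift_push; last first.
  by apply: tlift_linear; split=> ?; last lin; apply/lin_tensl/lin_homl/lin_id.
apply: eq_tlift => g h; rewrite tliftE //.
by split=> ?; last lin; apply/lin_tensl/lin_homl/lin_id.
Qed.

Definition homl_map : comod_hom (homl_comod W V) (homl_comod W' V') :=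
  @mkcomod k H (homl_comod W V) (homl_comod W' V') (mkhom homl_map_linear)
    homl_map_comod.
End HomlFunctor.

(* Main.v *)
(** The isomorphism is currying.  If [f : T ⊗ W -> V] is a comodule map, then
    f(t ⊗ w_0)_0 ⊗ f(t ⊗ w_0)_1 S(w_1) = f(t_0 ⊗ w_0) ⊗ t_1 w_1 S(w_2)
                                       = f(t_0 ⊗ w) ⊗ t_1,
    so that [rho (f (t ⊗ -))] lies in Hom(W, V) ⊗ H and equals the image of
    t_0 ⊗ t_1.  Conversely, if [g : T -> Hom^l(W, V)] is a comodule map, then
    g(t_0)(w_0) ⊗ t_1 w_1 = g(t)(w_0)_0 ⊗ g(t)(w_0)_1 S(w_1) w_2, which is the
    coaction of g(t)(w). *)

Require Import Defs.
From mathcomp Require Import all_boot all_algebra.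
Local Open Scope ring_scope.

Set Implicit Arguments.
Unset Strict Implicit.
Unset Printing Implicit Defensive.

Import GRing.Theory.

Section LinearCurrying.
Variables (k : fieldType) (T W V : lmodType k).

Lemma curry_linearr (f : linhom (T ⊗ W) V) t : linear (fun w => f (t ⊗t w)).
Proof. lin. Qed.

Lemma curry_linearl (f : linhom (T ⊗ W) V) :
  linear (fun t => mkhom (curry_linearr f t)).
Proof. by move=> a t t'; apply: homP => w /=; rewrite tens_linearl linearP. Qed.

Definition curry_hom (f : linhom (T ⊗ W) V) : linhom T (linhom W V) :=
  mkhom (curry_linearl f).

Lemma uncurry_linear (g : linhom T (linhom W V)) :
  linear (tlift (fun t w => g t w)).
Proof. lin. Qed.

Definition uncurry_hom (g : linhom T (linhom W V)) : linhom (T ⊗ W) V :=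
  mkhom (uncurry_linear g).

Lemma uncurry_homE g t w : uncurry_hom g (t ⊗t w) = g t w.
Proof. by rewrite mkhomE tliftE //; lin. Qed.

End LinearCurrying.

Section ComoduleCurrying.
Variables (k : fieldType) (H : hopfAlgebra k) (T W V : comodule H).

Lemma rho_curry (f : comod_hom (T ⊗c W) V) t w :
  rho (curry_hom f t) w =
  tlift (fun t0 t1 => curry_hom f t0 w ⊗t t1) (coact T t).
Proof.
(* Colinearity of [f] and the diagonal coaction on [T ⊗c W] give this form. Once coassociativity is
   applied, [w01] and [w1] become w_1 and w_2, so that w_1 S(w_2) appears. *)
transitivity (tlift (fun t0 t1 => tlift (fun w0 w1 => tlift (fun w00 w01 =>
    f (t0 ⊗t w00) ⊗t (t1 * w01 * antipode H w1)) (coact W w0)) (coact W w))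
  (coact T t)).
  rewrite /= /rho_fun [RHS]tlift_exchange; apply: eq_tlift => w0 w1 /=.
  rewrite (coact_sw f (t ⊗t w0)); last lin.
  rewrite [coact _ _]tensor_coactE tlift_push; last lin.
  apply: eq_tlift => t0 t1; rewrite tlift_push; last lin.
  by apply: eq_tlift => w00 w01; rewrite tliftE //; lin.
apply: eq_tlift => t0 t1.
rewrite (coactA_sw (F := fun w00 w01 w1 =>
  f (t0 ⊗t w00) ⊗t (t1 * w01 * antipode H w1))); last by split; lin.
(* Expanding [w] by the counit makes both sides sums over [coact W w], to be compared term by
   term. *)
rewrite -[RHS](coact_counit_sw (F := fun w => f (t0 ⊗t w) ⊗t t1)); last lin.
apply: eq_tlift => w0 w1; under eq_tlift => a b do rewrite -mulrA.
rewrite (antipoder_sw (F := fun x => f (t0 ⊗t w0) ⊗t (t1 * x))); last lin.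
by rewrite mulr1.
Qed.

Lemma curry_homl_subproof (f : comod_hom (T ⊗c W) V) t :
  curry_hom f t \in @homl_pred _ _ W V.
Proof.
(* The witness is f(t_0 ⊗ -) ⊗ t_1. *)
apply/homl_predP; exists (tmap (curry_hom f) (idhom H) (coact T t)).
by apply: homP => w; rewrite rho_curry hom_tensE tlift_tmap //; lin.
Qed.

Definition curry_homl_fun (f : comod_hom (T ⊗c W) V) (t : T) : homl W V :=
  Homl (curry_homl_subproof f t).

Lemma curry_homl_linear f : linear (curry_homl_fun f).
Proof. by move=> a t t'; apply: val_inj; apply: curry_linearl. Qed.

(** By [homl_tens_inj] it suffices to evaluate at each [w], and there the claim becomes
    [rho_curry]. *)
Lemma curry_homl_comod f t :
  coact (homl_comod W V) (mkhom (curry_homl_linear f) t) =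
  tmap (mkhom (curry_homl_linear f)) (idhom H) (coact T t).
Proof.
apply: homl_tens_inj => w; rewrite [LHS]homl_coactE [LHS]rho_curry.
rewrite tlift_tmap //.
by split=> ?; last lin; apply/lin_tensl/lin_homl/lin_id.
Qed.

Definition comod_curry_fun (f : comod_hom (T ⊗c W) V) :
    comod_hom T (homl_comod W V) :=
  @mkcomod k H T (homl_comod W V) (mkhom (curry_homl_linear f))
    (curry_homl_comod f).

Lemma comod_curry_linear : linear comod_curry_fun.
Proof.
by move=> a f g; apply: comod_hom_eq => t; apply/val_inj/homP => w.
Qed.

Definition comod_curry :
    linhom (comod_hom (T ⊗c W) V) (comod_hom T (homl_comod W V)) :=
  mkhom comod_curry_linear.

Lemma comod_curryE f t w : homl_val (comod_curry f t) w = f (t ⊗t w).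
Proof. by []. Qed.

(** Colinearity of [g] evaluated at [w]; it trades the coaction of [T] for [rho]. *)
Lemma comod_hom_homlE (g : comod_hom T (homl_comod W V)) t w :
  tlift (fun t0 t1 => homl_val (g t0) w ⊗t t1) (coact T t) =
  rho (homl_val (g t)) w.
Proof.
rewrite -homl_coactE -[homl_coact _ _ _]/(coact (homl_comod W V) (g t)).
rewrite comod_homP tlift_tmap //.
by split=> ?; last lin; apply/lin_tensl/lin_homl/lin_id.
Qed.

Lemma uncurry_homl_comod (g : comod_hom T (homl_comod W V)) x :
  let f := uncurry_hom (comp_hom (homl_incl W V) g) in
  coact V (f x) = tmap f (idhom H) (coact (T ⊗c W) x).
Proof.
move=> f; move: x; apply: tensor_ext => [||t w].
- lin.
- by move=> a x y; rewrite linearP tmap_linear.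
rewrite uncurry_homE [coact (T ⊗c W) _]tensor_coactE.
rewrite (tlift_push _ _ (tmap_linear _ _)).
(* On the right-hand side, [comod_hom_homlE] absorbs t_0 ⊗ t_1 into [rho] of g(t), leaving only the
   coaction of [W] to treat. *)
transitivity (tlift (fun w0 w1 => tlift (fun v h => v ⊗t (h * w1))
    (rho (homl_val (g t)) w0)) (coact W w)); last first.
  under [RHS]eq_tlift => t0 t1 do rewrite (tlift_push _ _ (tmap_linear _ _)).
  rewrite [RHS]tlift_exchange; apply: eq_tlift => w0 w1.
  rewrite -comod_hom_homlE tlift_push; last lin.
  by apply: eq_tlift => t0 t1; rewrite tmapE uncurry_homE tliftE //; lin.
(* Unfolding [rho] puts S([w01]) next to [w1]; coassociativity then turns the product into S(w_1)
   w_2. *)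
transitivity (tlift (fun w0 w1 => tlift (fun w00 w01 => tlift (fun v0 v1 =>
    v0 ⊗t (v1 * antipode H w01 * w1)) (coact V (homl_val (g t) w00)))
  (coact W w0)) (coact W w)); last first.
  by apply: eq_tlift => w0 w1; rewrite rhoE //; lin.
rewrite coactA_sw; last by split; lin.
rewrite -[LHS](coact_counit_sw (F := fun w => coact V (homl_val (g t) w)));
  last lin.
apply: eq_tlift => w0 w1; rewrite tlift_exchange.
(* Writing the coaction as a sum of pure tensors lets the counit scalar enter each term. *)
rewrite -{1}[coact V _]tlift_tens.
rewrite (tlift_push (f := fun z => (counit H w1 : k) *: z)); last lin.
apply: eq_tlift => v0 v1; under eq_tlift => a b do rewrite -mulrA.
rewrite (antipodel_sw (F := fun x => v0 ⊗t (v1 * x))); last lin.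
by rewrite mulr1.
Qed.

Definition comod_uncurry (g : comod_hom T (homl_comod W V)) :
    comod_hom (T ⊗c W) V :=
  @mkcomod k H (T ⊗c W) V (uncurry_hom (comp_hom (homl_incl W V) g))
    (uncurry_homl_comod g).

Lemma comod_uncurryE g t w : comod_uncurry g (t ⊗t w) = homl_val (g t) w.
Proof. exact: uncurry_homE. Qed.

Lemma comod_curryK : cancel comod_curry comod_uncurry.
Proof.
move=> f; apply: comod_hom_eq; apply: tensor_ext => [||t w]; [lin|lin|].
by rewrite comod_uncurryE.
Qed.

Lemma comod_uncurryK : cancel comod_uncurry comod_curry.
Proof.
move=> g; apply: comod_hom_eq => t; apply/val_inj/homP => w.
exact: comod_uncurryE.
Qed.

End ComoduleCurrying.

Theorem lemma2p2 (k : fieldType) (H : hopfAlgebra k)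
    (char0 : [pchar k] =i pred0) (antipode_inv : bijective (antipode H)) :
  exists Phi : forall T W V : comodule H,
      linhom (comod_hom (T ⊗c W) V) (comod_hom T (homl_comod W V)),
    (forall T W V : comodule H, bijective (Phi T W V)) /\
    (forall (T T' W W' V V' : comodule H) (a : comod_hom T' T)
       (b : comod_hom W' W) (c : comod_hom V V') (f : comod_hom (T ⊗c W) V),
       Phi T' W' V' (c ∘c f ∘c comod_tmap a b) =
       homl_map b c ∘c Phi T W V f ∘c a).
Proof.
exists (@comod_curry k H); split=> [T W V|T T' W W' V V' a b c f].
  exact: Bijective (@comod_curryK k H T W V) (@comod_uncurryK k H T W V).
apply: comod_hom_eq => t; apply/val_inj/homP => w.
(* Both sides of the naturality square send [w] to c(f(a(t) ⊗ b(w))). *)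
by rewrite comod_curryE /= tmapE.
Qed.
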